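(* For any formula $\phi$ of $\mathcal L$ and any enumeration $\{\xi_u\}_{u\in U}$ of nondeterministic partial recursive functions, the following are equivalent: (1) $\{\xi_u\}_{u\in U}\vDash\phi$; (2) $w\Vdash\phi$ for every world $w$ of every Kripke model; (3) $\vdash_\Re\phi$.
   Context: The language $\mathcal L$: formulas built from propositional variables and $\bot$ using $\rightarrow$ and a binary modality $\rhd$; $\wedge,\vee,\neg,\top$ defined as usual. The logic $\Re$: classical propositional logic in $\mathcal L$ plus axioms A1: $\phi\rhd\psi\rightarrow(\chi\rhd\psi\rightarrow(\phi\vee\chi)\rhd\psi)$, A2: $\bot\rhd\phi$, A3: $\phi\rhd\top$, with rules Modus Ponens and M: from $\phi_1\rightarrow\phi_2$ and $\psi_1\rightarrow\psi_2$ infer $\phi_2\rhd\psi_1\rightarrow\phi_1\rhd\psi_2$. Kripke model: a triple $\langle W,\rightarrow,\Vdash\rangle$ with $W$ a finite set of worlds, $\rightarrow$ a ternary relation written $u\rightarrow_w v$, $\Vdash$ a relation between worlds and propositional variables, extended by: $w\nVdash\bot$; $w\Vdash\phi\rightarrow\psi$ iff $w\nVdash\phi$ or $w\Vdash\psi$; $w\Vdash\phi\rhd\psi$ iff for all $u,v$ with $u\rightarrow_w v$ and $u\Vdash\phi$ there is $v'$ with $u\rightarrow_w v'$ and $v'\Vdash\psi$. Semantics: $U$ is a universe (e.g. all words over an alphabet) and $\{\xi_u\}_{u\in U}$ is an enumeration, indexed by elements of $U$, of all nondeterministic partial recursive functions from $U$ to $U$; $\xi_w(x)\subseteq U$ is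 the set of all values a machine for $\xi_w$ may return on input $x$. The enumeration is assumed to satisfy the following form of Kleene's recursion theorem: for any total recursive $f_1,\dots,f_n:U^n\to U$ there are $u_1,\dots,u_n\in U$ with $\xi_{u_i}\equiv\xi_{f_i(u_1,\dots,u_n)}$ for all $i$. A valuation $*$ maps propositional variables to subsets of $U$, extended by $\bot^*=\varnothing$, $(\phi\rightarrow\psi)^*=(U\setminus\phi^* )\cup\psi^*$, $(\phi\rhd\psi)^*=\{w\in U\mid\forall u\in\phi^*\ (\xi_w(u)\neq\varnothing\rightarrow\xi_w(u)\cap\psi^*\neq\varnothing)\}$. $\{\xi_u\}_{u\in U}\vDash\phi$ means $\phi^*=U$ for every valuation $*$. *)

(* Defs.v *)
From mathcomp Require Import all_boot.
From mathcomp Require Import boolp classical_sets.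

Set Implicit Arguments.
Unset Strict Implicit.
Unset Printing Implicit Defensive.

Local Open Scope classical_set_scope.

Inductive formula : Type :=
| Var of nat
| Bot
| Imp of formula & formula
| Rhd of formula & formula.

Definition Neg (phi : formula) : formula := Imp phi Bot.
Definition Top : formula := Neg Bot.
Definition Or (phi psi : formula) : formula := Imp (Neg phi) psi.
Definition And (phi psi : formula) : formula := Neg (Imp phi (Neg psi)).

(* [Ax_K], [Ax_S] and [Ax_DN] with modus ponens axiomatize classical
   propositional logic in the connectives [Imp] and [Bot]. *)
Inductive provable : formula -> Prop :=
| Ax_K phi psi : provable (Imp phi (Imp psi phi))
| Ax_S phi psi chi :
    provable (Imp (Imp phi (Imp psi chi)) (Imp (Imp phi psi) (Imp phi chi)))
| Ax_DN phi : provable (Imp (Neg (Neg phi)) phi)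
| Ax_A1 phi psi chi :
    provable (Imp (Rhd phi psi) (Imp (Rhd chi psi) (Rhd (Or phi chi) psi)))
| Ax_A2 phi : provable (Rhd Bot phi)
| Ax_A3 phi : provable (Rhd phi Top)
| Rule_MP phi psi : provable (Imp phi psi) -> provable phi -> provable psi
| Rule_M phi1 phi2 psi1 psi2 :
    provable (Imp phi1 phi2) -> provable (Imp psi1 psi2) ->
    provable (Imp (Rhd phi2 psi1) (Rhd phi1 psi2)).

(* [arrow w u v] is u ->_w v. *)
Record kripke_model : Type := KripkeModel {
  world : finType;
  arrow : world -> rel world;
  atom : world -> pred nat
}.

Fixpoint forces (M : kripke_model) (w : world M) (phi : formula) : Prop :=
  match phi with
  | Var p => atom w p
  | Bot => False
  | Imp phi psi => ~ forces w phi \/ forces w psi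
  | Rhd phi psi =>
      forall u v : world M, arrow w u v -> forces u phi ->
      exists v' : world M, arrow w u v' /\ forces v' psi
  end.

(* Kleene's schemes for the n-ary partial recursive functions on nat, together
   with a binary nondeterministic choice. *)
Inductive prog : nat -> Type :=
| Zero n : prog n
| Succ : prog 1
| Proj n of 'I_n : prog n
| Comp m n of prog m & ('I_m -> prog n) : prog n
| PrimRec n of prog n & prog n.+2 : prog n.+1
| Mu n of prog n.+1 : prog n
| Choice n of prog n & prog n : prog n.

(* [returns p x] is the set of all values that [p] may return on input [x].
   Every call to a subprogram is a separate run making its own choices; in
   [PrimRec], [s] lists the successive values of one run of the recursion; in
   [Mu], the search stops at the first tested [y] whose test returns 0. *)
Fixpoint returns n (p : prog n) : n.-tuple nat -> set nat :=
  match p in prog n return n.-tuple nat -> set nat with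
  | Zero n => fun _ => [set 0]
  | Succ => fun x => [set (thead x).+1]
  | Proj n i => fun x => [set tnth x i]
  | Comp m n g h => fun x =>
      [set y | exists v : m.-tuple nat,
         (forall i, returns (h i) x (tnth v i)) /\ returns g v y]
  | PrimRec n g h => fun x =>
      let k := thead x in let x' := [tuple of behead x] in
      [set y | exists s : nat -> nat,
         [/\ returns g x' (s 0),
             forall i, i < k -> returns h [tuple of i :: s i :: x'] (s i.+1)
           & s k = y]]
  | Mu n g => fun x =>
      [set y | returns g [tuple of y :: x] 0 /\
         forall z, z < y -> exists t, returns g [tuple of z :: x] t.+1]
  | Choice n f g => fun x => returns f x `|` returns g x
  end.

Fixpoint deterministic n (p : prog n) : Prop :=
  match p with
  | Zero _ | Succ | Proj _ _ => True
  | Comp _ _ g h => deterministic g /\ forall i, deterministic (h i)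
  | PrimRec _ g h => deterministic g /\ deterministic h
  | Mu _ g => deterministic g
  | Choice _ _ _ => False
  end.

(* Computability on a universe is computability on nat through a fixed
   numbering of its elements; e.g. the words over a nonempty finite alphabet,
   numbered by length and then lexicographically. *)
Record universe : Type := Universe {
  elt :> Type;
  code : elt -> nat;
  code_bij : bijective code
}.

(* A multivalued function sends x to the set of its possible values at x, which
   is empty where it is undefined. *)
Definition nondet_partial_recursive (U : universe) (F : U -> set U) : Prop :=
  exists p : prog 1, forall x y : U,
    F x y <-> returns p [tuple code x] (code y).

Definition total_recursive (U : universe) n (f : n.-tuple U -> U) : Prop :=
  exists p : prog n, deterministic p /\
    forall x : n.-tuple U, returns p (map_tuple (@code U) x) = [set code (f x)].

(* [=1] between functions into [set U] is equality of all their value sets. *)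
Definition kleene_recursion (U : universe) (xi : U -> U -> set U) : Prop :=
  forall n (f : 'I_n -> n.-tuple U -> U),
    (forall i, total_recursive (f i)) ->
    exists u : n.-tuple U, forall i, xi (tnth u i) =1 xi (f i u).

Definition enumeration (U : universe) (xi : U -> U -> set U) : Prop :=
  [/\ forall u, nondet_partial_recursive (xi u),
      forall F : U -> set U,
        nondet_partial_recursive F -> exists u, xi u =1 F
    & kleene_recursion xi].

Fixpoint interp (U : universe) (xi : U -> U -> set U) (V : nat -> set U)
    (phi : formula) : set U :=
  match phi with
  | Var p => V p
  | Bot => set0
  | Imp phi psi => (~` interp xi V phi) `|` interp xi V psi
  | Rhd phi psi =>
      [set w | forall u, interp xi V phi u ->
         xi w u !=set0 -> (xi w u `&` interp xi V psi) !=set0]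
  end.

Definition models (U : universe) (xi : U -> U -> set U) (phi : formula) : Prop :=
  forall V : nat -> set U, interp xi V phi = setT.

(* Main.v *)
(* Kripke completeness uses finite maximal consistent sets of subformulas, taken
   in several copies: the copy tagged by [psi] is meant to be a counterexample
   to some [phi |> psi], so its successors are all worlds refuting [psi].

   An enumeration refutes whatever a finite Kripke model refutes: the recursion
   theorem gives every function infinitely many indices, so the worlds can be
   realized, one modal depth at a time, by pairwise distinct programs whose
   graphs are finite and copy the ternary relation on the programs realizing the
   worlds at the previous depth. *)

Require Import Defs.
From HB Require Import structures.
From mathcomp Require Import all_boot.
From mathcomp Require Import boolp classical_sets.

Set Implicit Arguments.
Unset Strict Implicit.
Unset Printing Implicit Defensive.

Local Open Scope classical_set_scope.

HB.instance Definition _ := gen_eqMixin formula.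

(** * Derivability from hypotheses *)

(* With this recursion the deduction theorem holds by conversion. *)
Fixpoint derives (Gamma : seq formula) (phi : formula) : Prop :=
  if Gamma is gamma :: Gamma' then derives Gamma' (Imp gamma phi)
  else provable phi.

Lemma derives_provable Gamma phi : provable phi -> derives Gamma phi.
Proof.
elim: Gamma phi => [//|gamma Gamma IH] phi pr_phi /=.
by apply: IH; apply: Rule_MP pr_phi; apply: Ax_K.
Qed.

Lemma derives_MP Gamma phi psi :
  derives Gamma (Imp phi psi) -> derives Gamma phi -> derives Gamma psi.
Proof.
elim: Gamma phi psi => [|gamma Gamma IH] phi psi /=; first exact: Rule_MP.
move=> d_imp d_phi; apply: (IH) d_phi; apply: (IH) d_imp.
exact/derives_provable/Ax_S.
Qed.

Lemma provable_id phi : provable (Imp phi phi).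
Proof.
apply: Rule_MP (Ax_K phi phi); apply: Rule_MP (Ax_K phi (Imp phi phi)).
exact: Ax_S.
Qed.

Lemma derives_mem Gamma phi : phi \in Gamma -> derives Gamma phi.
Proof.
elim: Gamma => [//|gamma Gamma IH]; rewrite inE => /predU1P[->|/IH d_phi] /=.
  exact/derives_provable/provable_id.
by apply: derives_MP d_phi; apply/derives_provable/Ax_K.
Qed.

Lemma derives_trans Gamma Delta phi :
    (forall gamma, gamma \in Gamma -> derives Delta gamma) ->
  derives Gamma phi -> derives Delta phi.
Proof.
elim: Gamma phi => [|gamma Gamma IH] phi sub_GD; first exact: derives_provable.
move=> /= /IH d_imp; apply: (derives_MP (d_imp _)); last first.
  by apply: sub_GD; rewrite mem_head.
by move=> delta delta_in; apply: sub_GD; rewrite inE delta_in orbT.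
Qed.

Lemma derives_sub Gamma Delta phi :
  {subset Gamma <= Delta} -> derives Gamma phi -> derives Delta phi.
Proof. by move=> sGD; apply: derives_trans => gamma /sGD /derives_mem. Qed.

Lemma derives_exfalso Gamma phi : derives Gamma Bot -> derives Gamma phi.
Proof.
move=> d_bot; apply: (derives_MP (derives_provable _ (Ax_DN phi))).
by apply: derives_MP d_bot; apply/derives_provable/Ax_K.
Qed.

Lemma derives_contra Gamma phi psi :
  phi \in Gamma -> Neg phi \in Gamma -> derives Gamma psi.
Proof.
move=> phi_in nphi_in; apply/derives_exfalso.
exact: derives_MP (derives_mem nphi_in) (derives_mem phi_in).
Qed.

(** Under the extra hypothesis [Neg psi], the first premise refutes [phi]; the second then yields
    [psi], a contradiction, and double negation elimination concludes. *)
Lemma derives_cases Gamma phi psi :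
    derives (phi :: Gamma) psi -> derives (Neg phi :: Gamma) psi ->
  derives Gamma psi.
Proof.
move=> d_pos d_neg; apply: (derives_MP (derives_provable _ (Ax_DN psi))).
rewrite -/(derives (Neg psi :: Gamma) Bot).
have to_bot Delta : Neg psi \in Delta -> derives Delta psi -> derives Delta Bot.
  by move=> /derives_mem; apply: derives_MP.
apply: (to_bot (Neg psi :: Gamma)); first exact: mem_head.
have d_nphi : derives (Neg psi :: Gamma) (Neg phi).
  rewrite -/(derives (phi :: Neg psi :: Gamma) Bot).
  apply: (to_bot (phi :: Neg psi :: Gamma)); first by rewrite !inE eqxx orbT.
  by apply: derives_sub d_pos => x; rewrite !inE => /orP[]->; rewrite ?orbT.
apply: derives_trans d_neg => x; rewrite inE => /predU1P[->//|x_in].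
by apply: derives_mem; rewrite inE x_in orbT.
Qed.

(** By case analysis, each member of [l] in turn can be added, either itself or negated, while [chi]
    stays underivable. Deciding only a finite list is what keeps the set of worlds finite. *)
Lemma lindenbaum (l Gamma : seq formula) (chi : formula) :
    ~ derives Gamma chi ->
  exists Delta, [/\ {subset Gamma <= Delta}, ~ derives Delta chi &
    forall theta, theta \in l -> theta \in Delta \/ Neg theta \in Delta].
Proof.
elim: l Gamma => [|theta l IH] Gamma nd_chi; first by exists Gamma; split.
have [lit lit_or nd_lit] : exists2 lit, lit = theta \/ lit = Neg theta &
    ~ derives (lit :: Gamma) chi.
  case: (pselect (derives (theta :: Gamma) chi)) => [d_pos|]; last first.
    by exists theta; first left.
  exists (Neg theta); first by right.
  by move=> d_neg; apply: nd_chi; apply: derives_cases d_pos d_neg.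
have [Delta [sub_Delta nd_Delta compl]] := IH _ nd_lit.
have lit_in : lit \in Delta by apply: sub_Delta; rewrite mem_head.
exists Delta; split=> // [x x_in|x].
  by apply: sub_Delta; rewrite inE x_in orbT.
rewrite inE => /predU1P[->|/compl//].
by case: lit_or lit_in => ->; [left|right].
Qed.

Definition big_or (s : seq formula) : formula := foldr Or Bot s.

Lemma provable_big_or (s : seq formula) (phi : formula) :
  phi \in s -> provable (Imp phi (big_or s)).
Proof.
elim: s => [//|psi s IH]; rewrite inE => /predU1P[->|/IH pr] /=.
  apply: (@derives_contra [:: Neg psi; psi] psi); by rewrite !inE eqxx ?orbT.
apply: (@derives_MP [:: phi] (big_or s)) pr.
exact/derives_provable/Ax_K.
Qed.

(** A2 is the case of the empty disjunction, and A1 adds one disjunct at a time. *)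
Lemma derives_big_or_Rhd Gamma (s : seq formula) (psi : formula) :
    (forall phi, phi \in s -> derives Gamma (Rhd phi psi)) ->
  derives Gamma (Rhd (big_or s) psi).
Proof.
elim: s => [|phi s IH] d_s /=; first exact/derives_provable/Ax_A2.
apply: derives_MP (IH _).
  apply: derives_MP (d_s _ (mem_head _ _)).
  exact/derives_provable/Ax_A1.
by move=> x x_in; apply: d_s; rewrite inE x_in orbT.
Qed.

(** * Kripke completeness *)

Fixpoint subformulas (phi : formula) : seq formula :=
  phi :: match phi with
         | Var _ | Bot => [::]
         | Imp a b | Rhd a b => subformulas a ++ subformulas b
         end.

Lemma mem_subformulas phi : phi \in subformulas phi.
Proof. by case: phi => *; rewrite mem_head. Qed.

Lemma subformulas_trans phi psi :
  psi \in subformulas phi -> {subset subformulas psi <= subformulas phi}.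
Proof.
elim: phi => [n||a IHa b IHb|a IHa b IHb] /=;
  rewrite in_cons => /predU1P[->//|//];
  rewrite mem_cat => /orP[/IHa|/IHb] sub x /sub x_in;
  by rewrite inE mem_cat x_in ?orbT.
Qed.

Section CanonicalModel.

Variable phi0 : formula.
Let l := subformulas phi0.

Lemma closed_Imp a b : Imp a b \in l -> a \in l /\ b \in l.
Proof.
move=> /subformulas_trans sub; split; apply: sub;
  by rewrite /= inE mem_cat mem_subformulas ?orbT.
Qed.

Lemma closed_Rhd a b : Rhd a b \in l -> a \in l /\ b \in l.
Proof.
move=> /subformulas_trans sub; split; apply: sub;
  by rewrite /= inE mem_cat mem_subformulas ?orbT.
Qed.

(** A world stores only the members of [l] true in it. With the negations of the others added,
    consistency of the list expresses maximal consistency over [l]. *)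
Definition diagram (s : seq formula) : seq formula :=
  [seq if theta \in s then theta else Neg theta | theta <- l].

(* The second component is the formula that the successors of this copy of the
   world have to refute. *)
Definition canonical_world : Type :=
  {x : (size l).-tuple bool * 'I_(size l)
     | `[< ~ derives (diagram (mask x.1 l)) Bot >]}.

HB.instance Definition _ := Finite.on canonical_world.

Definition truths (w : canonical_world) : seq formula := mask (val w).1 l.

Definition target (w : canonical_world) : formula := nth Bot l (val w).2.

Lemma truths_sub w : {subset truths w <= l}.
Proof. by move=> x; apply: mem_mask. Qed.

Lemma target_mem w : target w \in l.
Proof. exact: mem_nth. Qed.

Lemma diagram_consistent w : ~ derives (diagram (truths w)) Bot.
Proof. exact/asboolP/(valP w). Qed.

(** A diagram contains each member of [l] or its negation, so a consistent one derives only those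
    members of [l] that it contains. *)
Lemma derives_truths w theta :
  theta \in l -> derives (diagram (truths w)) theta <-> theta \in truths w.
Proof.
move=> theta_l; have lit_in := map_f
  (fun theta => if theta \in truths w then theta else Neg theta) theta_l.
split=> [d_theta|theta_w]; last first.
  by rewrite theta_w in lit_in; apply: derives_mem.
apply: contrapT => /negP/negPf theta_w; rewrite theta_w in lit_in.
exact: diagram_consistent (derives_MP (derives_mem lit_in) d_theta).
Qed.

Lemma truths_Bot w : Bot \in l -> Bot \notin truths w.
Proof.
by move=> Bot_l; apply/negP => /(derives_truths w Bot_l)/diagram_consistent.
Qed.

Lemma truths_Imp w a b : Imp a b \in l ->
  Imp a b \in truths w <-> ~ a \in truths w \/ b \in truths w.
Proof.
move=> imp_l; have [a_l b_l] := closed_Imp imp_l.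
split=> [/(derives_truths w imp_l) d_imp|].
  case: (boolP (a \in truths w)) => a_w; [right|by left].
  apply/derives_truths => //; apply: derives_MP d_imp _.
  exact/derives_truths.
case=> [/negP/negPf a_w|b_w]; apply/derives_truths => //.
  have := map_f (fun theta => if theta \in truths w then theta else Neg theta)
    a_l; rewrite a_w => na_in.
  rewrite -/(derives (a :: diagram (truths w)) b).
  by apply: (@derives_contra (a :: diagram (truths w)) a);
    rewrite ?mem_head // in_cons na_in orbT.
apply: derives_MP (derives_provable _ (Ax_K b a)) _.
exact/derives_truths.
Qed.

(** Supplies every world used below, with a tag of choice: the trace on [l] of a Lindenbaum
    extension of [phi] that does not derive [chi]. Neither formula has to lie in [l], so [phi] may
    be [Top] and [chi] a disjunction. *)
Lemma canonical_world_exists phi chi psi :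
    ~ provable (Imp phi chi) -> psi \in l ->
  exists w, [/\ target w = psi, phi \in l -> phi \in truths w &
    forall theta, theta \in l -> provable (Imp theta chi) ->
      theta \notin truths w].
Proof.
move=> npr psi_l.
have [Delta [sub_Delta nd_chi compl]] := @lindenbaum l [:: phi] chi npr.
pose m : (size l).-tuple bool := [tuple of [seq theta \in Delta | theta <- in_tuple l]].
have mE theta : (theta \in mask m l) = (theta \in Delta) && (theta \in l).
  by rewrite /m /= -filter_mask mem_filter.
have psi_i : index psi l < size l by rewrite index_mem.
have consistent : `[< ~ derives (diagram (mask (m, Ordinal psi_i).1 l)) Bot >].
  (* Every member of the diagram lies in [Delta], which would then derive [chi] by ex falso. *)
  apply/asboolP => /= d_bot; apply: nd_chi; apply: derives_exfalso.
  apply: derives_sub d_bot => _ /mapP[theta theta_l ->]; rewrite mE theta_l andbT.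
  by case: ifP => // /negP; case: (compl _ theta_l).
pose w : canonical_world := exist _ (m, Ordinal psi_i) consistent.
exists w; split=> [|phi_l|theta theta_l pr_theta].
- exact: nth_index.
- by rewrite /truths mE phi_l sub_Delta ?mem_head.
rewrite /truths mE theta_l andbT; apply/negP => /derives_mem d_theta.
exact: nd_chi (derives_MP (derives_provable _ pr_theta) d_theta).
Qed.

(** The first clause does not mention [v]: it decides whether [u] may have successors at all. It
    ensures that whatever [w] promises at [u] can be fulfilled at a world refuting [target u]. *)
Definition canonical_arrow (w u v : canonical_world) : bool :=
  `[< (forall a b, Rhd a b \in truths w -> a \in truths u ->
         ~ provable (Imp b (target u))) /\
      target u \notin truths v >].

Definition canonical_model : kripke_model :=
  KripkeModel canonical_arrow (fun w p => Var p \in truths w).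

(* If every way of extending [a] were excluded by some [a' |> b'] in [w] with
   [b'] implying [b], then [a] would imply the disjunction of these [a'], and
   A1, A2 and M would give [a |> b]. *)
Lemma canonical_Rhd_witness w a b :
    Rhd a b \in l -> Rhd a b \notin truths w ->
  exists u, [/\ a \in truths u, target u = b &
    forall a' b', Rhd a' b' \in truths w -> a' \in truths u ->
      ~ provable (Imp b' b)].
Proof.
move=> rhd_l rhd_w; have [a_l b_l] := closed_Rhd rhd_l.
pose antecedent theta := if theta is Rhd a' b' then
  if `[< provable (Imp b' b) >] then Some a' else None else None.
pose s := pmap antecedent (truths w).
have npr : ~ provable (Imp a (big_or s)).
  move=> pr; move/negP: rhd_w; apply; apply/derives_truths => //.
  apply: derives_MP (derives_big_or_Rhd _).
    exact/derives_provable/(Rule_M pr (provable_id b)).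
  move=> phi; rewrite mem_pmap => /mapP[[p||c d|c d] //] th_w /=.
  case: asboolP => // pr_d [->].
  apply: derives_MP (derives_provable _ (Rule_M (provable_id c) pr_d)) _.
  by apply/derives_truths => //; apply: truths_sub th_w.
have [u [tgt a_u u_excl]] := canonical_world_exists npr b_l.
exists u; split=> // [|a' b' w_in u_in pr]; first exact: a_u.
have /provable_big_or pr_a' : a' \in s.
  rewrite mem_pmap; apply/mapP; exists (Rhd a' b') => //=.
  by case: asboolP.
by move/negP: (u_excl _ (truths_sub u_in) pr_a'); apply.
Qed.

Lemma truth_lemma (w : canonical_world) phi :
  phi \in l -> @forces canonical_model w phi <-> phi \in truths w.
Proof.
elim: phi w => [p||a IHa b IHb|a IHa b IHb] w phi_l //=.
- by split=> // H; move: (truths_Bot w phi_l); rewrite H.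
- have [a_l b_l] := closed_Imp phi_l.
  by rewrite truths_Imp // IHa // IHb.
have [a_l b_l] := closed_Rhd phi_l; split=> [forced|rhd_w u v].
  apply: contrapT => /negP rhd_w.
  (* A provable [b] would put [Rhd a b] in [w] by A3 and M. Hence some world refutes [b], so the
     argument [u] tagged by [b] has a successor, but none satisfying [b]. *)
  have npr_b : ~ provable (Imp Top b).
    move=> pr; move/negP: rhd_w; apply; apply/derives_truths => //.
    exact/derives_provable/(Rule_MP (Rule_M (provable_id a) pr))/Ax_A3.
  have [u [a_u tgt excl]] := canonical_Rhd_witness phi_l rhd_w.
  have [v [_ _ v_excl]] := canonical_world_exists npr_b b_l.
  have uv : canonical_arrow w u v.
    by apply/asboolP; rewrite tgt; split=> //; exact/v_excl/provable_id.
  have [|v' [/asboolP[_]]] := forced u v uv; first exact/IHa.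
  by rewrite tgt => /negP b_v' /IHb-/(_ b_l).
move=> /asboolP[excl _] /IHa-/(_ a_l) a_u.
(* By the first clause of the arrow, [b] does not provably imply the target, so some world satisfies
   [b] and refutes the target. *)
have [v' [_ b_v' v'_excl]] :=
  canonical_world_exists (excl _ _ rhd_w a_u) b_l.
exists v'; split; last by apply/IHb => //; apply: b_v'.
apply/asboolP; split=> //.
exact/v'_excl/provable_id/target_mem.
Qed.

End CanonicalModel.

Lemma kripke_complete phi :
  (forall (M : kripke_model) (w : world M), forces w phi) -> provable phi.
Proof.
move=> valid; apply: contrapT => npr.
have npr_top : ~ provable (Imp Top phi).
  by move=> pr; apply/npr/(Rule_MP pr)/provable_id.
have phi_l := mem_subformulas phi.
have [w [_ _ w_excl]] := canonical_world_exists npr_top phi_l.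
have := w_excl _ phi_l (provable_id phi); apply/negP/negPn.
exact/truth_lemma/(valid (canonical_model phi) w).
Qed.

(** * Soundness *)

(* Covers both semantics at once, with [R w u v] standing for [u ->_w v] or for
   [v] being a value of [xi_w(u)]. *)
Lemma soundness (T : Type) (R : T -> T -> T -> Prop)
    (S : formula -> T -> Prop) :
    (forall x, ~ S Bot x) ->
    (forall a b x, S (Imp a b) x <-> (S a x -> S b x)) ->
    (forall a b w, S (Rhd a b) w <->
       forall u v, R w u v -> S a u -> exists v', R w u v' /\ S b v') ->
  forall phi, provable phi -> forall x, S phi x.
Proof.
move=> SBot SImp SRhd phi; elim=> {phi}.
- by move=> phi psi x; rewrite !SImp.
- by move=> phi psi chi x; rewrite !SImp; tauto.
- move=> phi x; rewrite !SImp => nnphi; apply: contrapT => nphi.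
  by apply: (SBot x); apply: nnphi.
- move=> phi psi chi x; rewrite !SImp !SRhd => S1 S2 u v Ruv.
  rewrite !SImp => S_or; case: (pselect (S phi u)) => [/(S1 _ _ Ruv)//|nphi].
  by apply: (S2 _ _ Ruv); apply: S_or.
- by move=> phi x; rewrite SRhd => u v _ /SBot.
- move=> phi x; rewrite SRhd => u v Ruv _; exists v; split=> //.
  exact/SImp.
- by move=> phi psi _ Simp _ Sphi x; apply: (SImp phi psi x).1.
- move=> phi1 phi2 psi1 psi2 _ Sphi _ Spsi x; rewrite SImp !SRhd.
  move=> Srhd u v Ruv S1.
  have [v' [Rv' Sv']] := Srhd u v Ruv ((SImp _ _ _).1 (Sphi u) S1).
  by exists v'; split=> //; apply: (SImp _ _ _).1 (Spsi v') Sv'.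
Qed.

Lemma imply_notor (A B : Prop) : ~ A \/ B <-> (A -> B).
Proof. by split=> [[]|AB] //; case: (pselect A); tauto. Qed.

Lemma kripke_sound phi :
  provable phi -> forall (M : kripke_model) (w : world M), forces w phi.
Proof.
move=> pr M; pose R w u v := is_true (@arrow M w u v).
apply: (soundness (R := R) (S := fun phi w => @forces M w phi)) pr => [x []||].
  by move=> a b x; apply: imply_notor.
by [].
Qed.

Lemma interp_Imp (U : universe) (xi : U -> U -> set U) V a b x :
  interp xi V (Imp a b) x <-> (interp xi V a x -> interp xi V b x).
Proof. exact: imply_notor. Qed.

Lemma interp_Rhd (U : universe) (xi : U -> U -> set U) V a b w :
  interp xi V (Rhd a b) w <->
  forall u v, xi w u v -> interp xi V a u ->
    exists v', xi w u v' /\ interp xi V b v'.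
Proof.
split=> [H u v uv a_u|H u a_u [v uv]]; last exact: H uv a_u.
by apply: (H _ a_u); exists v.
Qed.

Lemma models_sound (U : universe) (xi : U -> U -> set U) phi :
  provable phi -> models xi phi.
Proof.
move=> pr V; apply/seteqP; split=> // x _.
apply: (soundness (R := xi) (S := interp xi V)) pr x => [x []||].
  exact: interp_Imp.
exact: interp_Rhd.
Qed.

(** * Recursive functions with finite description *)

Lemma returns_comp1 n (g : prog 1) (h : prog n) (x : n.-tuple nat) y :
  returns (Comp g (fun _ : 'I_1 => h)) x y <->
  exists2 z, returns h x z & returns g [tuple z] y.
Proof.
split=> [[v [/(_ ord0) hv gv]]|[z hz gz]].
  exists (tnth v ord0) => //; suff <- : v = [tuple tnth v ord0] by [].
  by apply/eq_from_tnth => j; rewrite !ord1.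
by exists [tuple z]; split=> // j; rewrite ord1.
Qed.

Lemma returns_PrimRec n (g : prog n) (h : prog n.+2) (x : n.+1.-tuple nat) y :
  returns (PrimRec g h) x y <->
  exists s : nat -> nat,
    [/\ returns g [tuple of behead x] (s 0),
        forall i, i < thead x ->
          returns h [tuple of i :: s i :: [tuple of behead x]] (s i.+1)
      & s (thead x) = y].
Proof. by []. Qed.

Lemma returns_Mu n (g : prog n.+1) (x : n.-tuple nat) y :
  returns (Mu g) x y <->
  returns g [tuple of y :: x] 0 /\
    forall z, z < y -> exists t, returns g [tuple of z :: x] t.+1.
Proof. by []. Qed.

Lemma returns_Choice n (f g : prog n) (x : n.-tuple nat) y :
  returns (Defs.Choice f g) x y <-> returns f x y \/ returns g x y.
Proof. by []. Qed.

Fixpoint const_prog n (c : nat) : prog n :=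
  if c is c'.+1 then Comp Succ (fun _ : 'I_1 => const_prog n c') else Zero n.

Lemma returns_const n c (x : n.-tuple nat) y :
  returns (const_prog n c) x y <-> y = c.
Proof.
elim: c y => [//|c IH] y; rewrite returns_comp1; split.
  by move=> [z /IH ->].
by move=> ->; exists c => //; apply/IH.
Qed.

Lemma deterministic_const n c : deterministic (const_prog n c).
Proof. by elim: c. Qed.

(** Induction on the threshold: primitive recursion answers [f 0] at 0 and, at successors, calls a
    program for the shifted function, whose threshold is one less. *)
Lemma eventually_const_recursive (f : nat -> nat) (N d : nat) :
    (forall n, N <= n -> f n = d) ->
  exists2 p : prog 1, deterministic p &
    forall n y, returns p [tuple n] y <-> y = f n.
Proof.
elim: N f => [|N IH] f fE.
  exists (const_prog 1 d); first exact: deterministic_const.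
  by move=> n y; rewrite returns_const fE.
have [//|p det_p pE] := IH (fun n => f n.+1).
  by move=> n leNn; apply: fE.
pose step : prog 2 := Comp p (fun _ : 'I_1 => Proj ord0).
have stepE (i b : nat) (x : 0.-tuple nat) y :
    returns step [tuple of i :: b :: x] y <-> y = f i.+1.
  rewrite returns_comp1; split=> [[_ -> /pE //]|->].
  by exists i => //; apply/pE.
exists (PrimRec (const_prog 0 (f 0)) step).
  by split; [exact: deterministic_const|].
move=> n y; rewrite returns_PrimRec; split=> [[s [/returns_const s0 sS <-]]|->].
  by case: n sS => [//|n] /(_ n (ltnSn n))/stepE.
by exists f; split=> // [|i _]; [exact/returns_const|exact/stepE].
Qed.

(** One nondeterministic branch per pair, each a constant restricted to a single input. *)
Lemma finite_graph_recursive (s : seq (nat * nat)) :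
  exists p : prog 1, forall x y, returns p [tuple x] y <-> (x, y) \in s.
Proof.
elim: s => [|[a b] s [q qE]].
  (* Searching for a zero of the constant 1 never succeeds, which gives the empty graph. *)
  exists (Mu (const_prog 2 1)) => x y; rewrite returns_Mu returns_const.
  by split=> // -[].
have [|t _ tE] := @eventually_const_recursive (fun n => n != a) a.+1 1.
  by move=> n lt_an; rewrite gtn_eqF.
pose test : prog 2 := Comp t (fun _ : 'I_1 => Proj (lift ord0 ord0)).
have testE z x y : returns test [tuple of z :: [tuple x]] y <-> y = (x != a).
  rewrite returns_comp1; split=> [[_ -> /tE //]|->].
  by exists x => //; apply/tE.
(* The value of [test] depends on [x] alone, so the search stops at 0 if [x = a] and fails
   otherwise. The composition is therefore defined at [a] only. *)
pose p := Comp (const_prog 1 b) (fun _ : 'I_1 => Mu test).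
have pE x y : returns p [tuple x] y <-> x = a /\ y = b.
  rewrite returns_comp1; split=> [[z /returns_Mu[]]|[-> ->]].
    by move=> /testE; case: eqP => // -> _ _ /returns_const.
  exists 0; last exact/returns_const.
  by apply/returns_Mu; split=> //; apply/testE; rewrite eqxx.
exists (Defs.Choice p q) => x y; rewrite returns_Choice pE qE inE xpair_eqE.
split=> [[[-> ->]|->]|/orP[/andP[/eqP -> /eqP ->]|->]]; rewrite ?eqxx ?orbT //.
  by left.
by right.
Qed.

(** * Arithmetical completeness *)

Section Enumeration.

Variables (U : universe) (xi : U -> U -> set U).
Hypothesis xi_enum : enumeration xi.

Lemma finite_graph_index (T : finType) (src tgt : T -> U) :
  exists u, forall x y, xi u x y <-> exists t, x = src t /\ y = tgt t.
Proof.
have [_ xi_onto _] := xi_enum.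
pose F x y := exists t, x = src t /\ y = tgt t.
have [|u uE] := xi_onto F; last by exists u => x y; rewrite uE.
have [p pE] := finite_graph_recursive
  [seq (code (src t), code (tgt t)) | t <- enum T].
exists p => x y; rewrite pE; split.
  by move=> [t [-> ->]]; apply: map_f; rewrite mem_enum.
move=> /mapP[t _ [/(bij_inj (@code_bij U)) -> /(bij_inj (@code_bij U)) ->]].
by exists t.
Qed.

(* Send an index [u] of [xi d] with [code u < N] to an index of another
   function, and every other [u] to [d]: a fixed point cannot be of the former
   kind, so it is an index of [xi d] with code at least [N]. *)
Lemma padding (d : U) (N : nat) : exists2 u, N <= code u & xi u = xi d.
Proof.
(* The empty function and the one with graph [{(d, d)}] are distinct, so [xi d] differs from one of
   them. *)
have [c c_neq] : exists c, xi c <> xi d.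
  have [e eE] := @finite_graph_index void (fun t => match t with end)
    (fun t => match t with end).
  case: (pselect (xi e = xi d)) => [ed|]; last by exists e.
  have [g gE] := @finite_graph_index unit (fun=> d) (fun=> d).
  exists g => gd; have : xi g d d by apply/gE; exists tt.
  by rewrite gd -ed eE => -[[]].
have [decode codeK decodeK] := @code_bij U.
pose f (u : U) : U := if (code u < N) && `[< xi u = xi d >] then c else d.
have [_ _ kleene] := xi_enum.
have [|us fixed] := kleene 1 (fun _ us => f (thead us)).
  move=> _.
  (* The test [xi u = xi d] is merely classical, but it matters at finitely many arguments only, so
     [f] is recursive. *)
  have [|p det_p pE] :=
    @eventually_const_recursive (fun n => code (f (decode n))) N (code d).
    by move=> n leNn; rewrite /f decodeK ltnNge leNn.
  exists p; split=> // x.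
  have -> : map_tuple (@code U) x = [tuple code (thead x)].
    by apply/eq_from_tnth => j; rewrite tnth_map !ord1.
  by apply/seteqP; split=> y; rewrite pE codeK.
have {}fixed : xi (thead us) = xi (f (thead us)) by apply/funext/(fixed ord0).
move: fixed; rewrite /f; case: ifP => [/andP[_ /asboolP ->]|out fixed].
  by move=> /esym/c_neq.
exists (thead us) => //.
by rewrite leqNgt; apply/negP => lt_N; move: out; rewrite lt_N fixed asboolT.
Qed.

(** Injectivity is gained one element of [T] at a time: the value there is replaced by an index
    whose code exceeds [N] and all codes of the current family. *)
Lemma padding_family (T : finType) (d : T -> U) (N : nat) :
  exists b : T -> U, [/\ injective b, forall t, N <= code (b t) &
    forall t, xi (b t) = xi (d t)].
Proof.
suff [b [b_inj bN bE]] : exists b : T -> U,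
    [/\ {in enum T &, injective b}, forall t, N <= code (b t) &
      forall t, xi (b t) = xi (d t)].
  exists b; split=> // t t' bt; apply: b_inj => //; exact: mem_enum.
elim: (enum T) => [|t s [b [b_inj bN bE]]].
  exists (fun t => s2val (cid2 (padding (d t) N))).
  by split=> // t; case: cid2.
have [u u_big uE] := padding (d t) (N + \max_(t' : T) code (b t')).+1.
have b_neq t' : b t' <> u.
  move=> bu; move: u_big; rewrite -bu ltnNge (leq_trans _ (leq_addl _ _)) //.
  exact: leq_bigmax.
exists (fun t' => if t' == t then u else b t'); split.
- move=> t1 t2; rewrite !inE.
  case: eqVneq => [->|_]; case: eqVneq => [->|_] //= t1s t2s.
  + by move=> /esym/b_neq.
  + by move=> /b_neq.
  exact: b_inj.
- by move=> t'; case: eqP => // _; apply: leq_trans (ltnW u_big); apply: leq_addr.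
- by move=> t'; case: eqP => // ->.
Qed.

Fixpoint depth (phi : formula) : nat :=
  match phi with
  | Var _ | Bot => 0
  | Imp a b => maxn (depth a) (depth b)
  | Rhd a b => (maxn (depth a) (depth b)).+1
  end.

(* Worlds are realized afresh at each modal depth [d], by programs acting on
   the programs which realize the worlds at depth [d - 1]; no self-reference is
   needed, but all these programs have to be distinct. Truth of formulas of
   depth below [d] depends on the valuation below [N] only. *)
Lemma realization (M : kripke_model) (d : nat) :
  exists (N : nat) (V : nat -> set U) (a : world M -> U),
    [/\ injective a, forall w, code (a w) < N &
      forall V' : nat -> set U,
        (forall p x, code x < N -> V' p x <-> V p x) ->
      forall phi w, depth phi < d -> interp xi V' phi (a w) <-> forces w phi].
Proof.
elim: d => [|d [N [V [a [a_inj a_lt aP]]]]].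
  have [decode codeK decodeK] := @code_bij U.
  (* No formula has depth below 0, so any injective naming of the worlds will do. *)
  exists #|world M|, (fun=> set0), (fun w => decode (enum_rank w)).
  split=> // [w w' /(can_inj decodeK)/val_inj/enum_rank_inj//|w].
  by rewrite decodeK.
have [e eE] : exists e : world M -> U, forall w x y, xi (e w) x y <->
    exists u v, [/\ x = a u, y = a v & arrow w u v].
  pose T w : finType := {uv : world M * world M | arrow w uv.1 uv.2}.
  have index w := cid (@finite_graph_index (T w)
    (fun t => a (val t).1) (fun t => a (val t).2)).
  exists (fun w => projT1 (index w)) => w x y; case: (index w) => u /= ->.
  split=> [[[[u1 v1] /= uv] [-> ->]]|[u1 [v1 [-> -> uv]]]].
    by exists u1, v1.
  by exists (exist _ (u1, v1) uv).
(* Worlds with the same arrows may share an index in [e]. Padding separates them and moves them to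
   codes from [N] on, where atoms can be valued without disturbing the previous stage. *)
have [b [b_inj b_ge bE]] := padding_family e N.
pose N' := N + (\max_w code (b w)).+1.
have b_lt w : code (b w) < N'.
  by rewrite /N' addnS ltnS (leq_trans _ (leq_addl _ _)) // leq_bigmax.
exists N', (fun p x => if code x < N then V p x else
  exists2 w, x = b w & atom w p), b.
split=> // V' V'E.
have agree p x : code x < N -> V' p x <-> V p x.
  move=> x_lt; rewrite V'E ?x_lt // (leq_trans x_lt) //; exact: leq_addr.
have {}aP := aP V' agree.
elim=> [p||phi IHphi psi IHpsi|phi _ psi _] w.
- move=> _ /=; rewrite V'E // ltnNge b_ge /=; split=> [[w' /b_inj ->//]|wp].
  by exists w.
- by [].
- rewrite [depth _]/= gtn_max => /andP[ltphi ltpsi].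
  by rewrite interp_Imp /= imply_notor IHphi // IHpsi.
(* Arguments and values of [xi (b w)] are realizations from the previous stage, so the subformulas
   are handled by [aP] rather than by induction on the formula. Injectivity of [a] recovers the
   world [u] from [a u]. *)
rewrite [depth _]/= !ltnS gtn_max => /andP[ltphi ltpsi].
rewrite interp_Rhd /=; split=> [H u v uv phi_u|H x y].
  have [||v' [xi_v' psi_v']] := H (a u) (a v).
  - by rewrite bE; apply/eE; exists u, v.
  - exact/aP.
  move: xi_v'; rewrite bE => /eE[u1 [v1 [/a_inj -> v'E uv1]]].
  by exists v1; split=> //; apply/aP; rewrite // -v'E.
rewrite bE => /eE[u [v [-> _ uv]]] /(aP _ _ ltphi) phi_u.
have [v' [uv' psi_v']] := H u v uv phi_u.
exists (a v'); split; first by apply/eE; exists u, v'.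
exact/aP.
Qed.

Lemma models_kripke phi :
  models xi phi -> forall (M : kripke_model) (w : world M), forces w phi.
Proof.
move=> valid M w; have [N [V [a [_ _ aP]]]] := realization M (depth phi).+1.
by apply/(aP V (fun _ _ _ => conj id id)) => //; rewrite valid.
Qed.

End Enumeration.

Theorem theorem5 (phi : formula) (U : universe) (xi : U -> U -> set U)
    (xi_enum : enumeration xi) :
  (models xi phi <->
     (forall (M : kripke_model) (w : world M), forces w phi)) /\
  ((forall (M : kripke_model) (w : world M), forces w phi) <->
     provable phi).
Proof.
split; split.
- exact: models_kripke.
- by move=> /kripke_complete/models_sound.
- exact: kripke_complete.
- exact: kripke_sound.
Qed.
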